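(* Consider the discrete-time system $x(k+1)=f(x(k),u(k),w(k))$ with $x(k)\in\mathcal{X}$, $u(k)\in\mathcal{U}$, $w(k)\in\mathcal{W}$ as described in the context, with control input set $\mathcal{U}=\bigcap_{k=1}^{N_u}\{u\in\mathbb{R}^{n_u}:\|\mathbf{U}_k u\|\le 1\}$ and exogenous input set $\mathcal{W}=\operatorname{co}\{w_1,\dots,w_{N_w}\}\ni 0$. Let $c,c_+\in\mathbb{R}^{n_x}$, let $\mathbf{P}_+$ be positive definite, $l\in\mathbb{R}^{n_u}$, $\bar u\in\mathcal{U}$, and let $\tilde f(x,u,w)=\mathbf{A}x+\mathbf{B}u+\mathbf{E}w+g$ be the linearization of $f$ around $\bar p=(c,\bar u,0)$. Suppose there exist a symmetric positive definite matrix $\mathbf{L}\in\mathbb{R}^{n_x\times n_x}$, a matrix $\mathbf{F}\in\mathbb{R}^{n_u\times n_x}$ and scalars $\delta_X\ge0$, $\delta_U\ge0$, $\phi\ge0$, $\beta_{ij}\ge0$, $\tau_k\ge0$ such that $$\begin{pmatrix}\mathbf{I}&\mathbf{L}\\ \bullet&\delta_X\mathbf{I}\end{pmatrix}\succeq0,$$ $$\begin{pmatrix}\phi\mathbf{I}&0&\mathbf{F}^\top\\ \bullet&\delta_U-\phi&(l-\bar u)^\top\\ \bullet&\bullet&\mathbf{I}\end{pmatrix}\succeq0,$$ $$\begin{pmatrix}\beta_{ij}\mathbf{I}&0&(\mathbf{A}\mathbf{L}+\mathbf{B}\mathbf{F})^\top\\ \bullet&1-\beta_{ij}&\mu^\top+V_i^\top+(\mathbf{E}w_j)^\top\\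 \bullet&\bullet&\mathbf{P}_+^{-1}\end{pmatrix}\succeq0,\quad i\in\{1,\dots,2^{n_x}\},\ j\in\{1,\dots,N_w\},$$ $$\begin{pmatrix}\tau_k\mathbf{I}&0&\mathbf{F}^\top\mathbf{U}_k^\top\\ \bullet&1-\tau_k&l^\top\mathbf{U}_k^\top\\ \bullet&\bullet&\mathbf{I}\end{pmatrix}\succeq0,\quad k\in\{1,\dots,N_u\},$$ where $\mu=g+\mathbf{A}c+\mathbf{B}l-c_+$, the $V_i$ ($i=1,\dots,2^{n_x}$) are the vertices of the hyperrectangle $\operatorname{H}(0,\tfrac12 L^{\mathrm{Lip}}r^2)$ with $r^2=\delta_X+\delta_U+\delta_W$ and $\delta_W=\max_{i=1,\dots,N_w}\|w_i\|^2$. Set $\mathbf{P}=\mathbf{L}^{-2}$, $\mathbf{K}=\mathbf{F}\mathbf{L}^{-1}$, $\xi=\operatorname{E}(c,\mathbf{P})$, $\xi_+=\operatorname{E}(c_+,\mathbf{P}_+)$ and $\kappa(x)=\mathbf{K}(x-c)+l$. Then under the constrained affine control law $u(k)=\kappa(x(k))$ one has $\kappa(\xi)\subseteq\mathcal{U}$ and $x(k+1)\in\xi_+$ for all $x(k)\in\xi$; that is, $f(x,\kappa(x),w)\in\xi_+$ for all $x\in\xi$ and all $w\in\mathcal{W}$.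
   Context: **System class.** $\mathcal{X}\subseteq\mathbb{R}^{n_x}$, $\mathcal{U}\subseteq\mathbb{R}^{n_u}$, $\mathcal{W}\subseteq\mathbb{R}^{n_w}$; $f:\mathcal{X}\times\mathcal{U}\times\mathcal{W}\to\mathcal{X}$ is a continuous nonlinear function whose Jacobian is globally Lipschitz continuous. $L^{\mathrm{Lip}}\in\mathbb{R}^{n_x}$ is the vector whose $i$-th entry is a Lipschitz constant of the gradient of the component $f_i$. The matrices $\mathbf{U}_k$ have appropriate dimensions, and $\operatorname{co}$ denotes the convex hull. The system's transition map is $F(x,u)=\{f(x,u,w):w\in\mathcal{W}\}$. The cells $\xi,\xi_+$ considered are subsets of $\mathcal{X}$, and $c\in\mathcal{X}$. **Linearization.** For $\bar p=(\bar x,\bar u,\bar w)$, $\tilde f(x,u,w)=\mathbf{A}x+\mathbf{B}u+\mathbf{E}w+g$, where $\mathbf{A},\mathbf{B},\mathbf{E}$ are the Jacobian matrices of $f$ with respect to $x,u,w$ at $\bar p$ and $g=f(\bar x,\bar u,\bar w)-\mathbf{A}\bar x-\mathbf{B}\bar u-\mathbf{E}\bar w$. The following component-wise bound is used as known: for all $(x,u,w)\in\mathcal{X}\times\mathcal{U}\times\mathcal{W}$ and all $i$, $|f_i(x,u,w)-\tilde f_i(x,u,w)|\le\tfrac12L^{\mathrm{Lip}}_i(\|x-\bar x\|^2+\|u-\bar u\|^2+\|w-\bar w\|^2)$. **Notation.** $\operatorname{E}(c,\mathbf{P})=\{x\in\mathbb{R}^n:(x-c)^\top\mathbf{P}(x-c)\le1\}$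 for positive definite $\mathbf{P}$; $\operatorname{H}(c,h)=\{x\in\mathbb{R}^n:|x_i-c_i|\le h_i,\ i=1,\dots,n\}$, so the vertices of $\operatorname{H}(0,h)$ are the $2^{n}$ vectors $(\pm h_1,\dots,\pm h_n)$. $\|\cdot\|$ is the Euclidean norm; $\succeq0$ means positive semidefinite; $\bullet$ denotes a block determined by symmetry. *)

(* Defs.v *)
From HB Require Import structures.
From mathcomp Require Import all_boot all_order all_algebra.
From mathcomp Require Import all_classical all_reals all_analysis.
Set Implicit Arguments.
Unset Strict Implicit.
Unset Printing Implicit Defensive.
Import Order.TTheory GRing.Theory Num.Theory.
Import numFieldNormedType.Exports.
Local Open Scope classical_set_scope.
Local Open Scope ring_scope.

Definition qform (R : realType) (n : nat) (M : 'M[R]_n) (x : 'cV[R]_n) : R :=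
  (x^T *m M *m x) 0 0.

Definition posdef (R : realType) (n : nat) (M : 'M[R]_n) : Prop :=
  M^T = M /\ forall x : 'cV[R]_n, x != 0 -> 0 < qform M x.

Definition possemidef (R : realType) (n : nat) (M : 'M[R]_n) : Prop :=
  M^T = M /\ forall x : 'cV[R]_n, 0 <= qform M x.

(* The library norm on matrices is the sup norm, whence an explicit
   Euclidean norm. *)
Definition enorm (R : realType) (n : nat) (x : 'cV[R]_n) : R :=
  Num.sqrt (\sum_(i < n) x i 0 ^+ 2).

Definition ellipsoid (R : realType) (n : nat) (c : 'cV[R]_n) (P : 'M[R]_n) :
    set 'cV[R]_n :=
  [set x | qform P (x - c) <= 1].

Definition convex_hull (R : realType) (n N : nat) (w : 'I_N -> 'cV[R]_n) :
    set 'cV[R]_n :=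
  [set x | exists a : 'I_N -> R,
     [/\ forall j, 0 <= a j, \sum_j a j = 1 & x = \sum_j a j *: w j]].

(* Indexing by s : {ffun 'I_n -> bool} enumerates the 2 ^ n sign patterns;
   s i = true selects the coordinate - h i. *)
Definition hrect_vertex (R : realType) (n : nat) (h : 'cV[R]_n)
    (s : {ffun 'I_n -> bool}) : 'cV[R]_n :=
  \col_i ((-1) ^+ s i * h i 0).

Definition symblock2 (R : realType) (n m : nat)
    (M11 : 'M[R]_n) (M12 : 'M[R]_(n, m)) (M22 : 'M[R]_m) : 'M[R]_(n + m) :=
  block_mx M11 M12
           M12^T M22.

Definition symblock3 (R : realType) (n m p : nat)
    (M11 : 'M[R]_n) (M12 : 'M[R]_(n, m)) (M13 : 'M[R]_(n, p))
    (M22 : 'M[R]_m) (M23 : 'M[R]_(m, p)) (M33 : 'M[R]_p) :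
    'M[R]_(n + (m + p)) :=
  symblock2 M11 (row_mx M12 M13) (symblock2 M22 M23 M33).

Notation xuw R nx nu nw := ('cV[R]_nx * 'cV[R]_nu * 'cV[R]_nw)%type.

Definition enorm3 (R : realType) (nx nu nw : nat)
    (p : xuw R nx nu nw) : R :=
  Num.sqrt (enorm p.1.1 ^+ 2 + enorm p.1.2 ^+ 2 + enorm p.2 ^+ 2).

(* A Jacobian is the triple of its blocks with respect to x, u and w. *)
Notation jac R nx nu nw :=
  ('M[R]_(nx, nx) * 'M[R]_(nx, nu) * 'M[R]_(nx, nw))%type.

Definition jac_apply (R : realType) (nx nu nw : nat) (J : jac R nx nu nw)
    (v : xuw R nx nu nw) : 'cV[R]_nx :=
  J.1.1 *m v.1.1 + J.1.2 *m v.1.2 + J.2 *m v.2.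

Definition jac_grad (R : realType) (nx nu nw : nat) (J : jac R nx nu nw)
    (i : 'I_nx) : xuw R nx nu nw :=
  ((row i J.1.1)^T, (row i J.1.2)^T, (row i J.2)^T).

(* The expansion is the one defining [differentiable], taken along the filter
   [within D (nbhs p)]: f is a function on D, which need not be open, and its
   values outside D are irrelevant. At interior points of D, J p is the usual
   Jacobian of f. *)
Definition is_jacobian_on (R : realType) (nx nu nw : nat)
    (D : set (xuw R nx nu nw))
    (f : xuw R nx nu nw -> 'cV[R]_nx)
    (J : xuw R nx nu nw -> jac R nx nu nw) : Prop :=
  forall p, D p -> forall q,
    f q = f p + jac_apply (J p) (q - p)
          +o_(q \near within D (nbhs p)) (q - p).

Definition grad_lipschitz_on (R : realType) (nx nu nw : nat)
    (D : set (xuw R nx nu nw))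
    (J : xuw R nx nu nw -> jac R nx nu nw)
    (Llip : 'cV[R]_nx) : Prop :=
  forall i, 0 <= Llip i 0 /\
    forall p q, D p -> D q ->
      enorm3 (jac_grad (J p) i - jac_grad (J q) i) <= Llip i 0 * enorm3 (p - q).

Definition lin_offset (R : realType) (nx nu nw : nat)
    (f : xuw R nx nu nw -> 'cV[R]_nx)
    (J : xuw R nx nu nw -> jac R nx nu nw)
    (p : xuw R nx nu nw) : 'cV[R]_nx :=
  f p - jac_apply (J p) p.

Definition input_set (R : realType) (nu Nu : nat) (m : 'I_Nu -> nat)
    (Uk : forall k, 'M[R]_(m k, nu)) : set 'cV[R]_nu :=
  [set u | forall k, enorm (Uk k *m u) <= 1].

(* Squared norms are nonnegative, so the neutral element 0 does not affect
   the maximum of a nonempty family. *)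
Definition max_sqnorm (R : realType) (n N : nat) (w : 'I_N -> 'cV[R]_n) : R :=
  \big[Num.max/0]_(j < N) enorm (w j) ^+ 2.

(* Main.v *)
(* Write x in xi as c + L y with |y| <= 1.  Each matrix inequality, through its
   Schur complement, bounds a quadratic form of an affine image of y: the first
   two give |x - c|^2 <= deltaX and |kappa x - ubar|^2 <= deltaU, so together
   with |v|^2 <= deltaW the linearization error of f lies in the box
   H(0, Llip r^2 / 2).  The error bound is obtained from the mean value theorem
   on the segment from (c, ubar, 0) to (x, kappa x, v), which stays in the
   domain because xi, U and W are convex.  By convexity of the target ellipsoid
   it suffices to treat the vertices V_s of the box and w_j of W, which the
   third inequality does; the fourth gives kappa x in U. *)
Require Import Defs.
From HB Require Import structures.
From mathcomp Require Import all_boot all_order all_algebra.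
From mathcomp Require Import all_classical all_reals all_analysis.
From mathcomp Require Import ring lra.
Import Order.TTheory GRing.Theory Num.Theory.
Import numFieldNormedType.Exports.
Local Open Scope classical_set_scope.
Local Open Scope ring_scope.

Set Implicit Arguments.
Unset Strict Implicit.
Unset Printing Implicit Defensive.

(** * Bilinear and quadratic forms *)

(** [M] may be rectangular so that off-diagonal blocks are covered: the cross terms of a block
    quadratic form are values of [bform]. *)
Definition bform (R : realType) (m n : nat) (M : 'M[R]_(m, n))
    (x : 'cV[R]_m) (y : 'cV[R]_n) : R :=
  (x^T *m M *m y) 0 0.

Lemma bform_qform (R : realType) n (M : 'M[R]_n) x : bform M x x = qform M x.
Proof. by []. Qed.

Lemma bformDl (R : realType) m n (M : 'M[R]_(m, n)) x y z :
  bform M (x + y) z = bform M x z + bform M y z.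
Proof. by rewrite /bform linearD /= !mulmxDl mxE. Qed.

Lemma bformDr (R : realType) m n (M : 'M[R]_(m, n)) x y z :
  bform M x (y + z) = bform M x y + bform M x z.
Proof. by rewrite /bform mulmxDr mxE. Qed.

Lemma bformBl (R : realType) m n (M : 'M[R]_(m, n)) x y z :
  bform M (x - y) z = bform M x z - bform M y z.
Proof. by apply/eqP; rewrite -subr_eq opprK -bformDl subrK. Qed.

Lemma bformZr (R : realType) m n (M : 'M[R]_(m, n)) a x y :
  bform M x (a *: y) = a * bform M x y.
Proof. by rewrite /bform -scalemxAr mxE. Qed.

Lemma bformNr (R : realType) m n (M : 'M[R]_(m, n)) x y :
  bform M x (- y) = - bform M x y.
Proof. by rewrite -scaleN1r bformZr mulN1r. Qed.

Lemma bform_sumr (R : realType) m n (M : 'M[R]_(m, n)) x N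
    (y : 'I_N -> 'cV_n) :
  bform M x (\sum_j y j) = \sum_j bform M x (y j).
Proof. by rewrite /bform mulmx_sumr summxE. Qed.

Lemma bform_tr (R : realType) m n (M : 'M[R]_(m, n)) x y :
  bform M^T y x = bform M x y.
Proof.
have -> : bform M^T y x = (x^T *m M *m y)^T 0 0.
  by rewrite !trmx_mul trmxK mulmxA.
by rewrite mxE.
Qed.

Lemma qformZ (R : realType) n (M : 'M[R]_n) a x :
  qform M (a *: x) = a ^+ 2 * qform M x.
Proof.
by rewrite /qform -scalemxAr linearZ /= -!scalemxAl !mxE mulrA expr2.
Qed.

Lemma qformN (R : realType) n (M : 'M[R]_n) x : qform M (- x) = qform M x.
Proof. by rewrite -scaleN1r qformZ sqrrN expr1n mul1r. Qed.

Lemma qform_scalar (R : realType) n (a : R) (x : 'cV_n) :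
  qform a%:M x = a * qform 1%:M x.
Proof. by rewrite /qform !mul_mx_scalar scale1r -scalemxAl mxE. Qed.

Lemma qform1E (R : realType) n (x : 'cV[R]_n) :
  qform 1%:M x = \sum_i x i 0 ^+ 2.
Proof.
by rewrite /qform mulmx1 mxE; apply: eq_bigr => i _; rewrite mxE expr2.
Qed.

Lemma qform1_mul (R : realType) m n (A : 'M[R]_(m, n)) (x : 'cV_n) :
  qform 1%:M (A *m x) = qform (A^T *m A) x.
Proof. by rewrite /qform mulmx1 trmx_mul !mulmxA. Qed.

(** * Euclidean norm and definite matrices *)

Lemma enorm_ge0 (R : realType) n (x : 'cV[R]_n) : 0 <= enorm x.
Proof. exact: sqrtr_ge0. Qed.

Lemma sqr_enorm (R : realType) n (x : 'cV[R]_n) : enorm x ^+ 2 = qform 1%:M x.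
Proof. by rewrite qform1E sqr_sqrtr // sumr_ge0 // => i _; rewrite sqr_ge0. Qed.

Lemma enorm_le1 (R : realType) n (x : 'cV[R]_n) :
  (enorm x <= 1) = (qform 1%:M x <= 1).
Proof. by rewrite -sqr_enorm expr_le1 // enorm_ge0. Qed.

Lemma possemidef1 (R : realType) n : possemidef (1%:M : 'M[R]_n).
Proof. by split=> [|x]; rewrite ?trmx1 // -sqr_enorm sqr_ge0. Qed.

Lemma posdef_psd (R : realType) n (M : 'M[R]_n) : posdef M -> possemidef M.
Proof.
move=> [Msym Mpos]; split=> // x; have [->|/Mpos/ltW//] := eqVneq x 0.
by rewrite /qform mulmx0 mxE.
Qed.

Lemma posdef_unitmx (R : realType) n (M : 'M[R]_n) : posdef M -> M \in unitmx.
Proof.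
move=> [_ Mpos]; rewrite unitmxE unitfE; apply/det0P => -[v v0 vM].
have := Mpos v^T; rewrite trmx_eq0 => /(_ v0).
by rewrite /qform trmxK vM mul0mx mxE ltxx.
Qed.

(** * Quadratic forms of block matrices and Schur complements *)

Lemma qform_symblock2 (R : realType) n m (M11 : 'M[R]_n) (M12 : 'M[R]_(n, m))
    (M22 : 'M[R]_m) x y :
  qform (symblock2 M11 M12 M22) (col_mx x y) =
  qform M11 x + qform M22 y + 2 * bform M12 x y.
Proof.
rewrite /qform /symblock2 tr_col_mx mul_row_block mul_row_col !mulmxDl.
rewrite mxE [X in X + _]mxE [X in _ + X]mxE.
by rewrite -/(bform M12 x y) -/(bform M12^T y x) bform_tr; ring.
Qed.

Lemma qform_symblock3 (R : realType) n m p (M11 : 'M[R]_n) (M12 : 'M[R]_(n, m))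
    (M13 : 'M[R]_(n, p)) (M22 : 'M[R]_m) (M23 : 'M[R]_(m, p)) (M33 : 'M[R]_p)
    x y z :
  qform (symblock3 M11 M12 M13 M22 M23 M33) (col_mx x (col_mx y z)) =
  qform M11 x + qform M22 y + qform M33 z +
  2 * (bform M12 x y + bform M13 x z + bform M23 y z).
Proof.
rewrite /symblock3 !qform_symblock2 {2}/bform mul_mx_row mul_row_col mxE.
by rewrite -/(bform M12 x y) -/(bform M13 x z); ring.
Qed.

(* Test the block matrix on (y, 1, - Q (G y + b)): the minimizer in the third
   block, which realizes the Schur complement. *)
Lemma qform_le_lmi (R : realType) n p (a s : R) (G : 'M[R]_(p, n)) (b : 'cV_p)
    (Q : 'M[R]_p) (y : 'cV_n) :
  Q^T = Q -> Q \in unitmx ->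
  possemidef (symblock3 a%:M (0 : 'cV_n) G^T s%:M b^T (invmx Q)) ->
  qform Q (G *m y + b) <= a * qform 1%:M y + s.
Proof.
move=> Qsym Qunit [_ /(_ (col_mx y (col_mx 1 (- (Q *m (G *m y + b))))))].
rewrite qform_symblock3 qform_scalar.
have -> : qform s%:M (1 : 'cV_1) = s.
  by rewrite qform_scalar qform1E big_ord1 mxE expr1n mulr1.
have -> : qform (invmx Q) (- (Q *m (G *m y + b))) = qform Q (G *m y + b).
  by rewrite qformN /qform trmx_mul Qsym mulmxA mulmxK // mulmxA.
have -> : bform (0 : 'cV_n) y (1 : 'cV_1) = 0.
  by rewrite /bform mulmx0 mul0mx mxE.
set z := G *m y + b.
have E : bform G^T y (- (Q *m z)) + bform b^T 1 (- (Q *m z)) = - qform Q z.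
  have zT : z^T = y^T *m G^T + b^T by rewrite linearD /= trmx_mul.
  rewrite !bformNr -opprD /bform /qform trmx1 mul1mx !mulmxA zT.
  by rewrite 2!mulmxDl [in RHS]mxE.
by rewrite add0r E; lra.
Qed.

(** * Convexity of positive semidefinite quadratic forms *)

(** Expand [qform M (x - y)], which is nonnegative. This inequality carries all the convexity
    arguments below. *)
Lemma bform_le_qform (R : realType) n (M : 'M[R]_n) x y : possemidef M ->
  2 * bform M x y <= qform M x + qform M y.
Proof.
move=> [Msym /(_ (x - y))]; rewrite -bform_qform bformDl !bformDr.
have -> : bform M (- y) x = - bform M x y by rewrite -bform_tr Msym bformNr.
by rewrite bformNr !bform_qform qformN; lra.
Qed.

Lemma qform_convex_hull (R : realType) n N (M : 'M[R]_n) (x : 'I_N -> 'cV_n)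
    r z : possemidef M -> (forall j, qform M (x j) <= r) ->
  convex_hull x z -> qform M z <= r.
Proof.
move=> psdM xr [a [a0 a1 zE]].
(* Only the second argument of [bform M z z] is expanded as a convex combination. The surplus
   [qform M z] on the right is absorbed by the factor 2 on the left. *)
have : 2 * qform M z <= \sum_j a j * (qform M z + r).
  rewrite -bform_qform {2}zE bform_sumr mulr_sumr; apply: ler_sum => j _.
  rewrite bformZr mulrCA ler_wpM2l // (le_trans (bform_le_qform _ _ psdM)) //.
  by rewrite bform_qform lerD2l.
by rewrite -mulr_suml a1; lra.
Qed.

(* The linear form [bform M (x + e)] is maximized over the box at the vertex
   whose signs are those of its coefficients. *)
Lemma qform_box (R : realType) n (M : 'M[R]_n) (x h e : 'cV_n) r :
  possemidef M -> (forall s, qform M (x + hrect_vertex h s) <= r) ->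
  (forall i, `|e i 0| <= h i 0) -> qform M (x + e) <= r.
Proof.
move=> psdM xr eh; set a := (x + e)^T *m M.
pose s := [ffun i => a 0 i < 0].
have ev : bform M (x + e) e <= bform M (x + e) (hrect_vertex h s).
  rewrite /bform -/a {}/s; move: a => a; rewrite !mxE.
  apply: ler_sum => i _; rewrite !mxE ffunE; have /ler_normlP[] := eh i.
  by case: ltP => a0 e1 e2; rewrite ?expr1 ?expr0; nra.
(* By [ev], [qform M (x + e)] is at most the bilinear form of [x + e] with the shifted vertex, and
   twice the latter is at most [qform M (x + e) + r]. *)
have := bform_le_qform (x + e) (x + hrect_vertex h s) psdM.
rewrite [bform _ _ (_ + hrect_vertex _ _)]bformDr; have := xr s.
rewrite -[qform M (x + e)]bform_qform [bform _ _ (x + e)]bformDr; lra.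
Qed.

(** * Cauchy-Schwarz inequality and stacked vectors *)

Lemma bform1_sqr_le (R : realType) n (x y : 'cV[R]_n) :
  bform 1%:M x y ^+ 2 <= qform 1%:M x * qform 1%:M y.
Proof.
have [_ psd] := possemidef1 R n.
have psdc a b : 0 <= a ^+ 2 * qform 1%:M x + b ^+ 2 * qform 1%:M y
                     + 2 * (a * b * bform 1%:M x y).
  have := psd (a *: x + b *: y); rewrite -bform_qform bformDl !bformDr.
  rewrite !bform_qform !qformZ.
  rewrite -[bform _ (b *: y) _]bform_tr trmx1 bformZr.
  rewrite -[bform _ (a *: x) _]bform_tr trmx1 bformZr.
  by rewrite -[bform _ y x]bform_tr trmx1; lra.
have [y0|y0] := eqVneq (qform 1%:M y) 0; last first.
  have yp : 0 < qform 1%:M y by rewrite lt_def y0 psd.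
  (* The minimizer of |x + s y|^2 is s = - <x, y> / |y|^2; both coefficients are multiplied by |y|^2
     to avoid the division. *)
  have := psdc (qform 1%:M y) (- bform 1%:M x y).
  have -> : forall p q t : R,
    q ^+ 2 * p + (- t) ^+ 2 * q + 2 * (q * - t * t) = q * (p * q - t ^+ 2).
    by move=> *; ring.
  by rewrite pmulr_rge0 // subr_ge0.
rewrite y0 mulr0 exprn_even_le0 //=; apply: contraT => c0.
(* If |y|^2 = 0 but <x, y> is nonzero, this coefficient makes the nonnegative expression equal to
   -1. *)
have := psdc 1 (- (qform 1%:M x + 1) / (2 * bform 1%:M x y)).
have -> : 2 * (1 * (- (qform 1%:M x + 1) / (2 * bform 1%:M x y))
               * bform 1%:M x y) = - qform 1%:M x - 1 by field.
by rewrite y0 expr1n mulr0 addr0; lra.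
Qed.

Lemma bform1_le (R : realType) n (x y : 'cV[R]_n) :
  `|bform 1%:M x y| <= enorm x * enorm y.
Proof.
rewrite -(@ler_pXn2r _ 2) ?nnegrE ?mulr_ge0 ?enorm_ge0 //.
by rewrite exprMn !sqr_enorm -normrX ger0_norm ?sqr_ge0 // bform1_sqr_le.
Qed.

(** In a single column, [enorm3] becomes a Euclidean norm and each entry of [jac_apply] a scalar
    product, so that Cauchy-Schwarz applies to triples. *)
Definition stack3 (R : realType) (nx nu nw : nat) (p : xuw R nx nu nw) :
    'cV[R]_(nx + nu + nw) :=
  col_mx (col_mx p.1.1 p.1.2) p.2.

Lemma stack3B (R : realType) nx nu nw (p q : xuw R nx nu nw) :
  stack3 (p - q) = stack3 p - stack3 q.
Proof. by rewrite /stack3 !opp_col_mx !add_col_mx. Qed.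

Lemma stack3Z (R : realType) nx nu nw a (p : xuw R nx nu nw) :
  stack3 (a *: p) = a *: stack3 p.
Proof. by rewrite /stack3 !scale_col_mx. Qed.

Lemma qform1_col_mx (R : realType) m n (x : 'cV[R]_m) (y : 'cV[R]_n) :
  qform 1%:M (col_mx x y) = qform 1%:M x + qform 1%:M y.
Proof.
rewrite !qform1E big_split_ord /=; congr (_ + _); apply: eq_bigr => i _.
  by rewrite col_mxEu.
by rewrite col_mxEd.
Qed.

Lemma enorm3E (R : realType) nx nu nw (p : xuw R nx nu nw) :
  enorm3 p = enorm (stack3 p).
Proof.
rewrite /enorm3 !sqr_enorm -!qform1_col_mx -sqr_enorm sqrtr_sqr.
by rewrite ger0_norm ?enorm_ge0.
Qed.

Lemma enorm3_ge0 (R : realType) nx nu nw (p : xuw R nx nu nw) : 0 <= enorm3 p.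
Proof. exact: sqrtr_ge0. Qed.

Lemma enorm3Z (R : realType) nx nu nw a (p : xuw R nx nu nw) : 0 <= a ->
  enorm3 (a *: p) = a * enorm3 p.
Proof.
move=> a0; apply/eqP; rewrite -(@eqrXn2 _ 2) ?mulr_ge0 ?enorm3_ge0 //.
by rewrite exprMn !enorm3E !sqr_enorm stack3Z qformZ.
Qed.

Lemma jac_applyE (R : realType) nx nu nw (K : jac R nx nu nw) v i :
  jac_apply K v i 0 = bform 1%:M (stack3 (jac_grad K i)) (stack3 v).
Proof.
rewrite /bform mulmx1 !tr_col_mx !mul_row_col !trmxK.
by rewrite -!row_mul !mxE.
Qed.

Lemma jac_applyZ (R : realType) nx nu nw (K : jac R nx nu nw) a v :
  jac_apply K (a *: v) = a *: jac_apply K v.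
Proof. by rewrite /jac_apply /= -!scalemxAr !scalerDr. Qed.

(** * Linearization error along a segment *)

(** The mean value theorem is applied to [h] corrected by [d * t] and a quadratic whose derivative
    is [M * t] up to sign. This gives the factor 1/2 without integration. *)
Lemma second_order_bound (R : realType) (h dh : R -> R) (d M : R) :
  {within `[0, 1], continuous h} ->
  (forall t : R, t \in `]0, 1[ -> is_derive t 1 h (dh t)) ->
  (forall t : R, t \in `]0, 1[ -> `|dh t - d| <= M * t) ->
  `|h 1 - h 0 - d| <= 2^-1 * M.
Proof.
move=> hc hd dhM.
have cid : {within `[0, 1], continuous (@id R)}.
  by apply: continuous_subspaceT => x; exact: cvg_id.
have aux (s : R) : exists2 t, t \in `]0, 1[ &
    h 1 - h 0 - d - s * (2^-1 * M) = dh t - d - s * (M * t).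
  pose k (t : R) := h t - d * t - s * (2^-1 * M) * t ^+ 2.
  have kd (t : R) : t \in `]0, 1[ ->
      is_derive t 1 k (dh t - d - s * (M * t)).
    move=> /hd hdt; rewrite /k; apply: is_derive_eq.
    by rewrite /GRing.scale /=; field.
  have kc : {within `[0, 1], continuous k}.
    move=> x; apply: cvgB; first apply: cvgB.
    - exact: hc.
    - by apply: cvgM; [exact: cvg_cst|exact: cid].
    - by apply: cvgM; [exact: cvg_cst|apply: cvgM; exact: cid].
  have [t t01 kE] := MVT ltr01 kd kc; exists t => //.
  by move: kE; rewrite subr0 mulr1 => <-; rewrite /k; field.
(* The sign [s = 1] gives the upper bound, [s = -1] the lower one. *)
have [t /dhM] := aux 1; have [u /dhM] := aux (- 1).
by rewrite !ler_norml; lra.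
Qed.

Lemma ler_entry_norm (R : realType) m n (A : 'M[R]_(m, n)) i j :
  `|A i j| <= `|A|.
Proof.
rewrite [leRHS]mx_normrE.
exact: (le_bigmax _ (fun k : 'I_m * 'I_n => `|A k.1 k.2|) (i, j)).
Qed.

Lemma jacobian_expansion (R : realType) nx nu nw (D : set (xuw R nx nu nw))
    f J q e :
  is_jacobian_on D f J -> D q -> 0 < e ->
  \forall x \near within D (nbhs q),
    `|f x - f q - jac_apply (J q) (x - q)| <= e * `|x - q|.
Proof.
move=> fJ Dq e0; near=> x.
rewrite (fJ q Dq x) -addrA -opprD addrC addKr.
by near: x; apply: littleoP.
Unshelve. all: by end_near. Qed.

Lemma cvg_line (R : realType) (V : normedModType R) (p v : V) (t : R) :
  p + s *: v @[s --> t] --> p + t *: v.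
Proof. by apply: cvgD; [exact: cvg_cst|apply: cvgZr_tmp; exact: cvg_id]. Qed.

(** A chain rule done by hand: the expansion of [f] holds only within [D], which suffices because
    the line stays in [D] for parameters near [t]. *)
Lemma is_derive_segment (R : realType) nx nu nw (D : set (xuw R nx nu nw))
    f J (p v : xuw R nx nu nw) i (t : R) :
  is_jacobian_on D f J -> D (p + t *: v) ->
  (\forall s \near t, D (p + s *: v)) ->
  is_derive t 1 (fun s => f (p + s *: v) i 0)
    (jac_apply (J (p + t *: v)) v i 0).
Proof.
set q := p + t *: v => fJ Dq Dnear.
set d := jac_apply (J q) v i 0; pose path (s : R) := p + s *: v.
suff cv : s^-1 *: (f (path (s *: 1 + t)) i 0 - f (path t) i 0) @[s --> 0^']
    --> d.
  by split; [apply/cvg_ex; exists d|exact: (cvg_lim _ cv)].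
have shiftc : s *: 1 + t @[s --> (0 : R)] --> t.
  rewrite -[X in _ --> X]add0r -[X in _ --> X + _](scale0r (1 : R)).
  by apply: cvgD; [apply: cvgZr_tmp; exact: cvg_id|exact: cvg_cst].
have pathc : path @ t --> q by exact: cvg_line.
apply/cvgrPdist_le => e e0.
(* After division by the increment the remainder is at most this constant times [|v|], hence at most
   [e]; the added 1 covers [v = 0]. *)
have e'0 : 0 < e / (`|v| + 1) by rewrite divr_gt0 // ltr_wpDl.
have fo : \forall s \near t, D (path s) ->
    `|f (path s) - f q - jac_apply (J q) (path s - q)|
      <= e / (`|v| + 1) * `|path s - q|.
  exact: pathc (jacobian_expansion fJ Dq e'0).
have {}fo : \forall s \near t,
    `|f (path s) - f q - jac_apply (J q) (path s - q)|
      <= e / (`|v| + 1) * `|path s - q|.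
  exact: filterS2 (fun s Ds h => h Ds) Dnear fo.
(* Reparametrize by the increment [s] near 0, as in the difference quotient. *)
have {fo}/nbhs_dnbhs fo := shiftc _ fo.
near=> s.
have s0 : s != 0 by near: s; exact: nbhs_dnbhs_neq.
have pathE : path (s *: 1 + t) - q = s *: v.
  by rewrite /path /q scalerDl addrCA [_%:A]mulr1 addrK.
have : `|f (path (s *: 1 + t)) - f q - s *: jac_apply (J q) v|
    <= e / (`|v| + 1) * `|s *: v|.
  rewrite -jac_applyZ -pathE.
  by near: s; exact: fo.
have entry (a b z : 'cV[R]_nx) :
    (a - b - s *: z) i 0 = a i 0 - b i 0 - s * z i 0 by rewrite !mxE.
move=> /(le_trans (ler_entry_norm _ i 0)); rewrite entry -/d normrZ => H.
rewrite -[path t]/q distrC /GRing.scale /=.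
have -> : s^-1 * (f (path (s * 1 + t)) i 0 - f q i 0) - d =
    s^-1 * (f (path (s * 1 + t)) i 0 - f q i 0 - s * d) by field.
rewrite normrM normfV ler_pdivrMl ?normr_gt0 //.
apply: le_trans H _; rewrite mulrCA ler_wpM2l //.
by rewrite mulrAC ler_pdivrMr ?ltr_wpDl // ler_pM2l // lerDl.
Unshelve. all: by end_near. Qed.

(** Apply [second_order_bound] to the [i]-th component of [f] along the segment, with [d] the
    directional derivative at [p] and [M] equal to [Llip i 0 * enorm3 v ^+ 2]. *)
Lemma linearization_bound (R : realType) nx nu nw (D : set (xuw R nx nu nw))
    f J Llip p q i :
  {within D, continuous f} -> is_jacobian_on D f J ->
  grad_lipschitz_on D J Llip ->
  (forall t : R, 0 <= t <= 1 -> D (p + t *: (q - p))) ->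
  `|f q i 0 - (f p + jac_apply (J p) (q - p)) i 0| <=
  2^-1 * (Llip i 0 * enorm3 (q - p) ^+ 2).
Proof.
move=> fc fJ /(_ i)[L0 JL] Dseg; set v := q - p.
pose h (s : R) := f (p + s *: v) i 0.
have -> : f q i 0 = h 1 by rewrite /h scale1r addrC subrK.
have -> : (f p + jac_apply (J p) v) i 0 = h 0 + jac_apply (J p) v i 0.
  by rewrite mxE /h scale0r addr0.
rewrite opprD addrA.
apply: second_order_bound (fun t => jac_apply (J (p + t *: v)) v i 0) _ _ _ _ _.
(* The endpoints may lie on the boundary of [D], so continuity on the closed interval comes from
   continuity of [f] within [D], not from differentiability. *)
- apply/subspace_continuousP => t t01.
  have Dt : D (p + t *: v) by apply: Dseg; move: t01; rewrite /= in_itv.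
  apply: (@cvg_comp _ _ _ (fun s : R => p + s *: v) (fun x => f x i 0) _
            (within D (nbhs (p + t *: v)))).
    move=> S SD.
    have : \forall s \near t, D (p + s *: v) -> S (p + s *: v).
      exact: cvg_line SD.
    apply: filterS => s DS s01.
    by apply/DS/Dseg; move: s01; rewrite /= in_itv.
  apply: (@cvg_comp _ _ _ f (fun x : 'cV[R]_nx => x i 0) _
            (nbhs (f (p + t *: v)))).
    by have /subspace_continuousP := fc; exact.
  exact: coord_continuous.
- move=> t t01; apply: (is_derive_segment _ fJ).
    by apply: Dseg; move: t01; rewrite in_itv /= => /andP[/ltW -> /ltW ->].
  apply: (filterS _ (near_in_itvoo t01)) => s.
  rewrite in_itv /= => /andP[s0 s1].
  by apply: Dseg; rewrite !ltW.
- move=> t; rewrite in_itv /= => /andP[t0 t1].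
  have Dt : D (p + t *: v) by apply: Dseg; rewrite !ltW.
  have Dp : D p by have := Dseg 0; rewrite scale0r addr0 lexx ler01; exact.
  (* One factor [enorm3 v] comes from Cauchy-Schwarz, the other, with [t], from the Lipschitz bound
     on the gradient. *)
  rewrite !jac_applyE -bformBl -stack3B.
  apply: le_trans (bform1_le _ _) _; rewrite -!enorm3E.
  have := JL _ _ Dt Dp; rewrite addrAC subrr add0r enorm3Z ?(ltW t0) //.
  move=> /ler_wpM2r; move=> /(_ _ (enorm3_ge0 v)) /le_trans; apply.
  by rewrite le_eqVlt; apply/orP; left; apply/eqP; ring.
Qed.

(** * Convexity along segments; bounds on state, input and disturbance *)

Lemma qform_segment (R : realType) n (M : 'M[R]_n) x y t r : possemidef M ->
  qform M x <= r -> qform M y <= r -> 0 <= t <= 1 ->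
  qform M (x + t *: (y - x)) <= r.
Proof.
move=> psdM xr yr /andP[t0 t1]; set z := x + _.
have : 2 * qform M z <= (1 - t) * (qform M z + r) + t * (qform M z + r).
  rewrite -[X in 2 * X <= _]bform_qform {2}/z bformDr bformZr bformDr bformNr.
  have := bform_le_qform z x psdM; have := bform_le_qform z y psdM; nra.
lra.
Qed.

Lemma convex_hull_segment (R : realType) n N (w : 'I_N -> 'cV[R]_n) x y t :
  convex_hull w x -> convex_hull w y -> 0 <= t <= 1 ->
  convex_hull w (x + t *: (y - x)).
Proof.
move=> [a [a0 a1 ->]] [b [b0 b1 ->]] /andP[t0 t1].
exists (fun j => a j + t * (b j - a j)); split=> [j||].
- by have := a0 j; have := b0 j; nra.
- by rewrite big_split /= -mulr_sumr sumrB a1 b1 subrr mulr0 addr0.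
- rewrite -sumrB scaler_sumr -big_split /=; apply: eq_bigr => j _.
  by rewrite scalerDl -scalerA scalerBl.
Qed.

Lemma qform1_le_lmi (R : realType) n p (a s : R) (G : 'M[R]_(p, n)) (b : 'cV_p)
    (y : 'cV_n) :
  possemidef (symblock3 a%:M (0 : 'cV_n) G^T s%:M b^T 1%:M) ->
  qform 1%:M (G *m y + b) <= a * qform 1%:M y + s.
Proof.
by move=> lmi; apply: qform_le_lmi; rewrite ?trmx1 ?unitmx1 ?invmx1.
Qed.

(** The squared norm is convex, so a bound at the generators extends to their hull. *)
Lemma max_sqnorm_ge (R : realType) n N (w : 'I_N -> 'cV[R]_n) x :
  convex_hull w x -> qform 1%:M x <= max_sqnorm w.
Proof.
apply: qform_convex_hull (possemidef1 R n) _ => j.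
by rewrite -sqr_enorm; apply: le_bigmax.
Qed.

(** The change of variables that presents the ellipsoid of shape [invmx (L *m L)] as the image of
    the unit ball under [L]. *)
Lemma qform_invmx_sqr (R : realType) n (L : 'M[R]_n) x :
  L^T = L -> L \in unitmx ->
  qform (invmx (L *m L)) x = qform 1%:M (invmx L *m x).
Proof.
move=> Lsym Lu; have LLu : L *m L \in unitmx by rewrite unitmx_mul Lu.
rewrite qform1_mul trmx_inv Lsym; congr (qform _ x).
rewrite -[RHS]mul1mx -(mulVmx LLu) -!mulmxA [L *m (invmx L *m _)]mulmxA.
by rewrite mulmxV // mul1mx mulmxV // mulmx1.
Qed.

(** Here the Schur complement is taken of the first block: for given [y], the minimizer there is
    [- (L *m y)]. *)
Lemma qform_le_lmi2 (R : realType) n (L : 'M[R]_n) d y :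
  L^T = L -> possemidef (symblock2 1%:M L d%:M) ->
  qform 1%:M (L *m y) <= d * qform 1%:M y.
Proof.
move=> Lsym [_ /(_ (col_mx (- (L *m y)) y))].
rewrite qform_symblock2 qformN qform_scalar.
have -> : bform L (- (L *m y)) y = - qform 1%:M (L *m y).
  by rewrite -bform_tr bformNr Lsym /bform /qform mulmx1 trmx_mul Lsym.
lra.
Qed.

Theorem theorem2 (R : realType) (nx nu nw Nu Nw : nat)
  (X : set 'cV[R]_nx)
  (m : 'I_Nu -> nat) (Uk : forall k : 'I_Nu, 'M[R]_(m k, nu))
  (w : 'I_Nw -> 'cV[R]_nw)
  (f : xuw R nx nu nw -> 'cV[R]_nx)
  (J : xuw R nx nu nw -> jac R nx nu nw)
  (Llip : 'cV[R]_nx)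
  (c cp : 'cV[R]_nx) (Pp : 'M[R]_nx) (l ubar : 'cV[R]_nu)
  (L : 'M[R]_nx) (F : 'M[R]_(nu, nx))
  (deltaX deltaU phi : R)
  (beta : {ffun 'I_nx -> bool} -> 'I_Nw -> R) (tau : 'I_Nu -> R) :
  let U : set 'cV[R]_nu := input_set Uk in
  let W : set 'cV[R]_nw := convex_hull w in
  let D : set (xuw R nx nu nw) := X `*` U `*` W in
  let pbar : xuw R nx nu nw := (c, ubar, 0) in
  let A : 'M[R]_nx := (J pbar).1.1 in
  let B : 'M[R]_(nx, nu) := (J pbar).1.2 in
  let E : 'M[R]_(nx, nw) := (J pbar).2 in
  let g : 'cV[R]_nx := lin_offset f J pbar in
  let mu : 'cV[R]_nx := g + A *m c + B *m l - cp in
  let deltaW : R := max_sqnorm w in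
  let r2 : R := deltaX + deltaU + deltaW in
  let V : {ffun 'I_nx -> bool} -> 'cV[R]_nx :=
    hrect_vertex ((2^-1 * r2) *: Llip) in
  let P : 'M[R]_nx := invmx (L *m L) in
  let K : 'M[R]_(nu, nx) := F *m invmx L in
  let xi : set 'cV[R]_nx := ellipsoid c P in
  let xip : set 'cV[R]_nx := ellipsoid cp Pp in
  let kappa : 'cV[R]_nx -> 'cV[R]_nu := fun x => K *m (x - c) + l in
  (forall p, D p -> X (f p)) ->
  {within D, continuous f} ->
  is_jacobian_on D f J ->
  grad_lipschitz_on D J Llip ->
  W 0 ->
  X c ->
  U ubar ->
  posdef Pp ->
  posdef L ->
  xi `<=` X ->
  xip `<=` X ->
  0 <= deltaX -> 0 <= deltaU -> 0 <= phi ->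
  (forall s j, 0 <= beta s j) ->
  (forall k, 0 <= tau k) ->
  possemidef (symblock2 1%:M L deltaX%:M) ->
  possemidef (symblock3 phi%:M (0 : 'cV[R]_nx) F^T
                        (deltaU - phi)%:M (l - ubar)^T
                        1%:M) ->
  (forall s j,
     possemidef (symblock3 (beta s j)%:M (0 : 'cV[R]_nx) (A *m L + B *m F)^T
                           (1 - beta s j)%:M (mu^T + (V s)^T + (E *m w j)^T)
                           (invmx Pp))) ->
  (forall k,
     possemidef (symblock3 (tau k)%:M (0 : 'cV[R]_nx) (F^T *m (Uk k)^T)
                           (1 - tau k)%:M (l^T *m (Uk k)^T)
                           1%:M)) ->
  kappa @` xi `<=` U /\
  (forall x v, xi x -> W v -> xip (f (x, kappa x, v))).
Proof.
move=> U W D pbar A B E g mu deltaW r2 V P K xi xip kappa.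
move=> _ fc fJ JL W0 _ Ubar Pppos Lpos xiX _ dX0 dU0 phi0 beta0 tau0 lmiX lmiU
  lmiF lmiT.
have Lu := posdef_unitmx Lpos; have Lsym := proj1 Lpos.
have Ppu := posdef_unitmx Pppos; have Ppsd := posdef_psd Pppos.
pose y x := invmx L *m (x - c).
have xiE x : xi x -> qform 1%:M (y x) <= 1.
  by rewrite /xi /ellipsoid /= qform_invmx_sqr.
have kappaE x : kappa x = F *m y x + l by rewrite /kappa mulmxA.
have kappaU x : xi x -> U (kappa x).
  move=> /xiE y1 k; rewrite enorm_le1 kappaE mulmxDr mulmxA.
  (* The matrix inequality bounds the squared norm by tau |y|^2 + 1 - tau, which is at most 1 since
     |y| <= 1 and tau >= 0. The multipliers [phi] and [beta] act in the same way below. *)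
  have := lmiT k; rewrite -!trmx_mul => /qform1_le_lmi - /(_ (y x)).
  by have := tau0 k; nra.
split=> [_ [x /kappaU xU <-]//|x v xix Wv].
have y1 := xiE x xix; set q : xuw R nx nu nw := (x, kappa x, v).
have xcE : x - c = L *m y x by rewrite mulKVmx.
have Dseg t : 0 <= t <= 1 -> D (pbar + t *: (q - pbar)).
  move=> t01; split; first split.
  (* The ellipsoid is centred at [c], so moving towards [c] multiplies its form by [t ^+ 2]. *)
  - apply: xiX; rewrite /xi /ellipsoid /=.
    rewrite addrAC subrr add0r qformZ qform_invmx_sqr //.
    have [_ /(_ (y x))] := possemidef1 R nx; rewrite -/(y x); nra.
  - move=> k; rewrite enorm_le1 qform1_mul.
    apply: qform_segment => //; rewrite -?qform1_mul -?enorm_le1.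
    - split=> [|z]; first by rewrite trmx_mul trmxK.
      by rewrite -qform1_mul -sqr_enorm sqr_ge0.
    - exact: Ubar.
    - exact: kappaU.
  - exact: convex_hull_segment.
have normr2 : enorm3 (q - pbar) ^+ 2 <= r2.
  rewrite enorm3E sqr_enorm !qform1_col_mx /=.
  have xd : qform 1%:M (x - c) <= deltaX.
    rewrite xcE; have := qform_le_lmi2 (y x) Lsym lmiX; nra.
  have ud : qform 1%:M (kappa x - ubar) <= deltaU.
    have := qform1_le_lmi (y x) lmiU; rewrite kappaE -addrA; nra.
  have vd : qform 1%:M (v - 0) <= deltaW by rewrite subr0; exact: max_sqnorm_ge.
  by apply: lerD => //; exact: lerD.
set e := f q - (f pbar + jac_apply (J pbar) (q - pbar)).
have eV i : `|e i 0| <= ((2^-1 * r2) *: Llip) i 0.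
  have [Li0 _] := JL i.
  rewrite /e mxE [X in _ + X]mxE.
  apply: le_trans (linearization_bound i fc fJ JL Dseg) _.
  rewrite mxE; have := enorm3_ge0 (q - pbar); nra.
(* The closed-loop linearization is affine in [y x] and [v]: the terms in [ubar] cancel and the
   constants collect into [mu]. *)
have fqE : f q - cp = (mu + (A *m L + B *m F) *m y x + E *m v) + e.
  rewrite /e /mu /g /lin_offset /jac_apply /= -/A -/B -/E kappaE subr0 xcE.
  rewrite !mulmx0 !addr0 mulmxBr mulmxDr mulmxDl -!mulmxA.
  move: (f q) (f pbar) (A *m c) (B *m ubar) (B *m l) (A *m (L *m y x)) => *.
  move: (B *m (F *m y x)) (E *m v) => *.
  by apply/colP => i; rewrite !mxE; ring.
(* First replace the error by a vertex [V s] with [v] fixed; then, for that vertex, write [v] as a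
   convex combination of the [w j]. *)
rewrite /xip /ellipsoid /= fqE; apply: (qform_box Ppsd _ eV) => s.
have [a [a0 a1 vE]] := Wv.
apply: (qform_convex_hull (x := fun j => (A *m L + B *m F) *m y x
    + (mu + V s + E *m w j)) Ppsd) => [j|].
  have := lmiF s j; rewrite -!linearD /= => /(qform_le_lmi (y x)).
  have := proj1 Pppos => /[swap] /[apply] /(_ Ppu); have := beta0 s j; nra.
(* The weights of [v] also serve for the translated points, because they sum to 1. *)
exists a; split=> //.
under [RHS]eq_bigr do rewrite scalerDr [X in _ + X]scalerDr addrA.
rewrite 2!big_split /= -!scaler_suml a1 !scale1r vE mulmx_sumr.
under eq_bigr do rewrite scalemxAr.
by rewrite -/(V s) (addrC mu) -!addrA (addrC (V s)).
Qed.
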